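(* Let $I$ be a quasi prime and radical right ideal of $\mathbb{H}[q_1,\ldots,q_n]$ such that $\mathbb{S}_{\mathcal{V}_c(I)}$ is irreducible. Then $\mathcal{V}_c(I)$ is irreducible.
   Context: $\mathbb{H}$ is the skew field of quaternions, $\mathbb{S}=\{J\in\mathbb{H}: J^2=-1\}$, and for $K\in\mathbb{S}$, $\mathbb{C}_K=\mathbb{R}+\mathbb{R}K$. $\mathbb{H}[q_1,\ldots,q_n]$ is the set of slice regular polynomials, i.e. functions $P:\mathbb{H}^n\to\mathbb{H}$, $P(q_1,\ldots,q_n)=\sum q_1^{\ell_1}\cdots q_n^{\ell_n}a_{\ell_1,\ldots,\ell_n}$ (finite sum, variables in this order, coefficients in $\mathbb{H}$ on the right). It is a ring under pointwise sum and the $*$-product determined by $(q^{\ell}a)*(q^{m}b)=q^{\ell+m}ab$ for multi-indices $\ell,m$, where $q^\ell=q_1^{\ell_1}\cdots q_n^{\ell_n}$. For a right ideal $I$, $\mathcal{V}(I)\subseteq\mathbb{H}^n$ is the set of common zeros of all $P\in I$, and $\mathcal{V}_c(I)=\mathcal{V}(I)\cap\bigcup_{K\in\mathbb{S}}\mathbb{C}_K^n$. The regular conjugate of $P=\sum q^\ell a_\ell$ is $P^c=\sum q^\ell\,\overline{a_\ell}$; the symmetrization of $P$ is $P^s=P*P^c=P^c*P$. A right ideal $J$ is completely prime if, whenever $P*Q\in J$ and $P*J\subseteq J$, either $P\in J$ or $Q\in J$. The radical $\sqrt{I}$ of a right ideal $I$ is the intersection of all completely prime right ideals containing $I$; $I$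 is radical if $\sqrt{I}=I$. A right ideal $I$ is quasi prime if, whenever $P*Q\in I$, either $P\in I$ or $Q^s\in I$. For $\mathbf{a}=(a_1,\ldots,a_n)\in\mathbb{H}^n$, $\mathbb{S}_{\mathbf{a}}=\{(g^{-1}a_1g,\ldots,g^{-1}a_ng): g\in\mathbb{H}\setminus\{0\}\}$, and $\mathbb{S}_{\mathcal{V}_c(I)}=\bigcup_{\mathbf{a}\in\mathcal{V}_c(I)}\mathbb{S}_{\mathbf{a}}$. The set $\mathbb{S}_{\mathcal{V}_c(I)}$ is again of the form $\mathcal{V}_c(J)$ for a right ideal $J$, namely $J=\langle P^s:P\in I\rangle$. A set $Z$ of the form $\mathcal{V}_c(J)$, $J$ a right ideal, is reducible if there exist proper, non-trivial right ideals $I_1,I_2$ of $\mathbb{H}[q_1,\ldots,q_n]$ with $Z=\mathcal{V}_c(I_1)\cup\mathcal{V}_c(I_2)$, where neither of $\mathcal{V}_c(I_1),\mathcal{V}_c(I_2)$ is contained in the other; otherwise it is irreducible. *)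

(* Defs.v *)
From HB Require Import structures.
From mathcomp Require Import all_boot all_order all_algebra.
From mathcomp Require Import ring.
From mathcomp Require Import classical_sets reals.
From mathcomp Require Import mpoly.

Set Implicit Arguments.
Unset Strict Implicit.
Unset Printing Implicit Defensive.

Import Order.TTheory GRing.Theory Num.Theory.

Local Open Scope ring_scope.
Local Open Scope classical_set_scope.

(* Quat a b c d is a + b i + c j + d k. *)
Record quat (R : Type) := Quat { qre : R; qi : R; qj : R; qk : R }.

Section QuatRing.
Variable R : realFieldType.
Implicit Types x y z : quat R.

Definition quat_tuple x := (qre x, qi x, qj x, qk x).
Definition tuple_quat (t : R * R * R * R) :=
  let: (a, b, c, d) := t in Quat a b c d.

Lemma quat_tupleK : cancel quat_tuple tuple_quat.
Proof. by case. Qed.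

HB.instance Definition _ := Choice.copy (quat R) (can_type quat_tupleK).

Definition addq x y :=
  Quat (qre x + qre y) (qi x + qi y) (qj x + qj y) (qk x + qk y).
Definition oppq x := Quat (- qre x) (- qi x) (- qj x) (- qk x).
Definition mulq x y :=
  Quat (qre x * qre y - qi x * qi y - qj x * qj y - qk x * qk y)
       (qre x * qi y + qi x * qre y + qj x * qk y - qk x * qj y)
       (qre x * qj y - qi x * qk y + qj x * qre y + qk x * qi y)
       (qre x * qk y + qi x * qj y - qj x * qi y + qk x * qre y).

Lemma addqA : associative addq.
Proof. by move=> [????] [????] [????]; rewrite /addq /= !addrA. Qed.
Lemma addqC : commutative addq.
Proof. by move=> [a b c d] [a' b' c' d']; congr Quat; apply: addrC. Qed.
Lemma add0q : left_id (Quat 0 0 0 0) addq.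
Proof. by move=> [????]; rewrite /addq /= !add0r. Qed.
Lemma addNq : left_inverse (Quat 0 0 0 0) oppq addq.
Proof. by move=> [????]; rewrite /addq /= !addNr. Qed.

HB.instance Definition _ := GRing.isZmodule.Build (quat R) addqA addqC add0q addNq.

Lemma mulqA : associative mulq.
Proof. by move=> [????] [????] [????]; congr Quat => /=; ring. Qed.
Lemma mul1q : left_id (Quat 1 0 0 0) mulq.
Proof. by move=> [????]; congr Quat => /=; ring. Qed.
Lemma mulq1 : right_id (Quat 1 0 0 0) mulq.
Proof. by move=> [????]; congr Quat => /=; ring. Qed.
Lemma mulqDl : left_distributive mulq addq.
Proof. by move=> [????] [????] [????]; congr Quat => /=; ring. Qed.
Lemma mulqDr : right_distributive mulq addq.
Proof. by move=> [????] [????] [????]; congr Quat => /=; ring. Qed.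
Lemma oneq_neq0 : Quat 1 0 0 0 != 0 :> quat R.
Proof. by apply/eqP => -[] /eqP; rewrite oner_eq0. Qed.

HB.instance Definition _ := GRing.Zmodule_isNzRing.Build (quat R)
  mulqA mul1q mulq1 mulqDl mulqDr oneq_neq0.

Definition conjq x := Quat (qre x) (- qi x) (- qj x) (- qk x).
Definition normq2 x : R := qre x ^+ 2 + qi x ^+ 2 + qj x ^+ 2 + qk x ^+ 2.
Definition scaleq (r : R) x := Quat (r * qre x) (r * qi x) (r * qj x) (r * qk x).
Definition invq x := scaleq (normq2 x)^-1 (conjq x).

Lemma normq2_eq0 x : (normq2 x == 0) = (x == 0).
Proof.
case: x => a b c d; rewrite /normq2 /=.
rewrite !paddr_eq0 ?addr_ge0 ?sqr_ge0 // !sqrf_eq0.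
apply/idP/eqP => [|[-> -> -> ->]]; last by rewrite !eqxx.
by case/andP => /andP[/andP[/eqP-> /eqP->] /eqP->] /eqP->.
Qed.

Lemma mulVq : {in [pred x : quat R | x != 0], left_inverse 1 invq *%R}.
Proof.
move=> x /=; rewrite inE -normq2_eq0; case: x => a b c d; rewrite /normq2 /= => h.
by congr Quat; rewrite /= /normq2 /=; field.
Qed.

Lemma mulqV : {in [pred x : quat R | x != 0], right_inverse 1 invq *%R}.
Proof.
move=> x /=; rewrite inE -normq2_eq0; case: x => a b c d; rewrite /normq2 /= => h.
by congr Quat; rewrite /= /normq2 /=; field.
Qed.

Lemma unitq_subproof x y : y * x = 1 /\ x * y = 1 -> x \in [pred x : quat R | x != 0].
Proof.
case=> _ h; rewrite inE; apply: contra_eq_neq h => ->.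
by rewrite mul0r eq_sym oneq_neq0.
Qed.

Lemma invq_out : {in [predC [pred x : quat R | x != 0]], invq =1 id}.
Proof.
move=> x; rewrite !inE negbK => /eqP ->.
by congr Quat; rewrite /= ?oppr0 mulr0.
Qed.

HB.instance Definition _ := GRing.NzRing_hasMulInverse.Build (quat R)
  mulVq mulqV unitq_subproof invq_out.

Lemma unitqE x : (x \is a GRing.unit) = (x != 0).
Proof. by []. Qed.

Lemma conjq_is_zmod_morphism : zmod_morphism conjq.
Proof. by move=> [????] [????]; congr Quat => /=; ring. Qed.

HB.instance Definition _ :=
  GRing.isZmodMorphism.Build (quat R) (quat R) conjq conjq_is_zmod_morphism.

Definition realq (r : R) : quat R := Quat r 0 0 0.

End QuatRing.

Section SliceRegular.
Variables (R : realType) (n : nat).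

Local Notation H := (quat R).

(* The indeterminates of {mpoly H[n]} commute with each other and with the
   coefficients, so its product is the *-product (see slpoly_mulE). Since
   evaluation is not multiplicative, it is defined separately, with ordered
   powers on the left and coefficients on the right. *)
Local Notation slpoly := {mpoly H[n]}.
Local Notation point := ('I_n -> H).

Implicit Types (P Q : slpoly) (I J : set slpoly) (a : point).

Lemma slpoly_mulE (l m : 'X_{1.. n}) (c d : H) :
  (c *: 'X_[l] : slpoly) * (d *: 'X_[m]) = (c * d) *: 'X_[(l + m)%MM].
Proof.
rewrite -!mul_mpolyC -mulrA [X in _ * X]mulrA -(commr_mpolyX l d%:MP).
by rewrite -mulrA -mpolyXD mulrA mpolyCM.
Qed.

(* \prod over 'I_n is taken in increasing order of the index. *)
Definition sleval P a : H :=
  \sum_(m <- msupp P) (\prod_(i < n) a i ^+ m i) * P@_m.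

Definition rconj P : slpoly := map_mpoly (@conjq R) P.

Lemma mcoeff_rconj P (m : 'X_{1.. n}) : (rconj P)@_m = conjq P@_m.
Proof. exact: mcoeff_map_mpoly. Qed.

Definition symm P : slpoly := P * rconj P.

Definition right_ideal I : Prop :=
  [/\ I 0, forall P Q, I P -> I Q -> I (P + Q) & forall P Q, I P -> I (P * Q)].

Definition imag_units : set H := [set K | K ^+ 2 = -1].

Definition slice (K : H) : set H :=
  [set q | exists x y : R, q = realq x + realq y * K].

Definition V I : set point := [set a | forall P, I P -> sleval P a = 0].

Definition Vc I : set point :=
  V I `&` \bigcup_(K in imag_units) [set a | forall i, slice K (a i)].

Definition completely_prime J : Prop :=
  forall P Q, J (P * Q) -> (forall A, J A -> J (P * A)) -> J P \/ J Q.

Definition radical I : set slpoly :=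
  [set P | forall J, right_ideal J -> completely_prime J -> I `<=` J -> J P].

Definition is_radical I : Prop := radical I = I.

Definition quasi_prime I : Prop :=
  forall P Q, I (P * Q) -> I P \/ I (symm Q).

Definition sphere a : set point :=
  [set b | exists g : H, g != 0 /\ forall i, b i = g^-1 * a i * g].

Definition sphere_set (Z : set point) : set point := \bigcup_(a in Z) sphere a.

Definition reducible (Z : set point) : Prop :=
  exists I1 I2 : set slpoly,
    [/\ right_ideal I1 /\ right_ideal I2,
        I1 <> [set 0] /\ I1 <> setT,
        I2 <> [set 0] /\ I2 <> setT,
        Z = Vc I1 `|` Vc I2
      & ~ (Vc I1 `<=` Vc I2) /\ ~ (Vc I2 `<=` Vc I1)].

Definition irreducible (Z : set point) : Prop := ~ reducible Z.

End SliceRegular.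

(* Main.v *)
Require Import Defs.
From HB Require Import structures.
From mathcomp Require Import all_boot all_order all_algebra.
From mathcomp Require Import finmap boolp classical_sets functions cardinality.
From mathcomp Require Import reals mpoly complex ring lra.

Set Implicit Arguments.
Unset Strict Implicit.
Unset Printing Implicit Defensive.

Import Order.TTheory GRing.Theory Num.Theory.
Import complex.

Local Open Scope ring_scope.
Local Open Scope classical_set_scope.

(** Restrict a slice regular polynomial P to the sphere of a complex point z,
    that is to the points x + y J, for J an imaginary unit, where z = x + y i.
    It reads a + J b with a and b independent of J, and P |-> a + i b is a ring
    morphism to the complexified quaternions, in which i is central. So on a
    sphere a right ideal vanishes nowhere, at one point, or everywhere. Real
    polynomials are central and their value on the sphere is their value at z.

    Strong Nullstellensatz.  Let I be quasi prime and radical. Then the real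
    polynomials in I form a radical ideal p, and H[q]/I has no real torsion
    outside p. If P vanishes on Vc(I) then P belongs to I
    ([strong_nullstellensatz]). Indeed every complex zero z of p lies under a
    point of Vc(I), because the symmetrizations of the elements of I lie in p,
    so that I maps to elements of norm zero at z ([common_zero]). At that point both
    P and any G in I vanish, which forces G^c * P to vanish on the whole sphere
    ([rconj_mul_vanishes]). The complex Nullstellensatz, applied to the real
    components of G^c * P, puts G^c * P in I, and then
    P * (G + G^c) = G * P + G^c * P is in I. As G + G^c is real, P is in I as
    soon as some G + G^c is not; otherwise I is generated by p and the
    Nullstellensatz applies to the components of P themselves.

    The Nullstellensatz over the complex numbers is proved for uncountable
    algebraically closed fields: for a transcendental x in a finitely generated
    algebra, the elements x - c cannot all be invertible, since their inverses
    would form an uncountable linearly independent family in a space of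
    countable dimension ([avoids_adjoin]).

    The theorem.  Suppose Vc(I) is the union of V1 = Vc(I1) and V2 = Vc(I2),
    neither containing the other. Choose P1 in I1 not zero at some point of V2
    and P2 in I2 not zero at some point of V1; neither is in I. Hence if f is
    real and P1 * f (or P2 * f) vanishes on Vc(I), then f is in I. Taking for f
    the symmetrizations of the elements of I2, with P1, shows that V2 meets
    every sphere that Vc(I) meets. Now take for f a component of P1, with P2.
    At a point of V1 where f is not zero, P1 does not vanish identically on the
    sphere, so V1 meets the sphere at that point only; V2 meets it as well,
    hence contains that point (if V2 met it elsewhere, Vc(I) would contain the
    whole sphere, V2 would contain it except possibly at one point, hence
    completely). So P2 * f vanishes on Vc(I), and f is in I. Thus all the
    components of P1 vanish on Vc(I), against the choice of P1. *)

(** * Uncountability of the reals *)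

Lemma uncountable_infinite_fiber (T : choiceType) (phi : T -> nat * nat) :
  ~ countable [set: T] -> exists k, infinite_set (phi @^-1` [set k]).
Proof.
move=> uncT; apply: contrapT => /forallNP finphi; apply: uncT.
suff -> : [set: T] = \bigcup_(k in [set: nat * nat]) (phi @^-1` [set k]).
  apply: bigcup_countable => [|k _]; first exact: countableP.
  by apply: finite_set_countable; apply: contrapT; apply: finphi.
by apply/seteqP; split=> // x _; exists (phi x).
Qed.

(** Nested intervals: the k-th step leaves [s k] out of the closed interval. *)
Fixpoint avoiding (R : realType) (s : nat -> R) (k : nat) : R * R :=
  if k is k'.+1 then
    let: (a, b) := avoiding s k' in
    let m := (a + b) / 2 in
    if s k' < m then (m, b) else (a, (a + m) / 2)
  else (0, 1).

Lemma real_uncountable (R : realType) : ~ countable [set: R].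
Proof.
move=> /countable_injP[f finj].
pose s k := xget 0 [set x : R | f x = k].
have sf x : s (f x) = x.
  rewrite /s; case: xgetP => [y _ /= fy|/(_ x)[]//].
  by apply: finj => //; apply: mem_set.
pose a k := (avoiding s k).1; pose b k := (avoiding s k).2.
have ab k : a k < b k.
  rewrite /a /b; elim: k => [|k /=]; first by rewrite ltr01.
  by case: (avoiding s k) => u v /= ltuv; case: ifP => _ /=; lra.
have step k : a k <= a k.+1 /\ b k.+1 <= b k.
  move: (ab k); rewrite /a /b /=.
  by case: (avoiding s k) => u v /= ltuv; case: ifP => _ /=; split; lra.
have a_le : {homo a : i j / (i <= j)%N >-> i <= j}.
  by apply: homo_leq => [//|? ? ?|k]; [exact: le_trans|case: (step k)].
have b_ge : {homo b : i j / (i <= j)%N >-> j <= i}.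
  apply: homo_leq => [//|? ? ? xy yz|k]; [exact: le_trans yz xy|].
  by case: (step k).
have aleb i j : a i <= b j.
  apply: le_trans (a_le _ _ (leq_maxl i j)) (le_trans (ltW (ab _)) _).
  exact: b_ge (leq_maxr i j).
pose x := sup (range a).
have xb j : x <= b j.
  by apply: ge_sup; [exists (a 0%N), 0%N|move=> _ [i _ <-]].
have ax j : a j <= x.
  by apply: ub_le_sup; [exists (b 0%N) => _ [i _ <-]|exists j].
move: (xb (f x).+1) (ax (f x).+1) (ab (f x)); rewrite /a /b /=.
move: (sf x); case: (avoiding s (f x)) => u v /= ->; case: ifP => /=; lra.
Qed.

(** * The Nullstellensatz over an uncountable algebraically closed field *)

Definition ideal (A : comNzRingType) (I : set A) : Prop :=
  [/\ I 0, forall p q, I p -> I q -> I (p + q) & forall p q, I p -> I (p * q)].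

(** The ideal stays proper after inverting [f]; this is what survives the
    successive specializations of the variables. *)
Definition avoids (A : comNzRingType) (I : set A) (f : A) : Prop :=
  forall k, ~ I (f ^+ k).

Definition adjoin (A : comNzRingType) (I : set A) (x : A) : set A :=
  [set p | exists u, I (p - u * x)].

Lemma adjoin_ideal (A : comNzRingType) (I : set A) (x : A) :
  ideal I -> ideal (adjoin I x).
Proof.
case=> I0 ID IM; split.
- by exists 0; rewrite mul0r subr0.
- move=> p q [u Iu] [v Iv]; exists (u + v).
  by rewrite mulrDl opprD addrACA; apply: ID.
- move=> p q [u Iu]; exists (u * q).
  by rewrite mulrAC -mulrBl; apply: IM.
Qed.

Section Nullstellensatz.

Variables (F : closedFieldType) (n : nat).
Local Notation A := {mpoly F[n]}.
Implicit Types (I : set A) (f x : A).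

(** Polynomials of bounded degree form a finite dimensional space. *)
Lemma bounded_lin_dep d (u : 'I_#|{: 'X_{1..n < d}}|.+1 -> A) :
  (forall j, (msize (u j) <= d)%N) ->
  exists2 l : 'I_#|{: 'X_{1..n < d}}|.+1 -> F,
    exists j, l j != 0 & \sum_j l j *: u j = 0.
Proof.
set N := #|_| => ud.
pose M : 'M[F]_(N.+1, N) := \matrix_(j, i) (u j)@_(val (enum_val i)).
have : kermx M != 0.
  rewrite -mxrank_eq0 mxrank_ker -lt0n subn_gt0 ltnS.
  exact: rank_leq_col.
case/rowV0Pn => v /sub_kermxP vM v0.
exists (fun j => v 0 j).
  by case/rV0Pn: v0 => j; exists j.
apply/mpolyP => m; rewrite mcoeff0 linear_sum /=.
have [md|dm] := ltnP (mdeg m) d; last first.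
  apply: big1 => j _; rewrite mcoeffZ.
  have /eqP -> : (u j)@_m == 0; last by rewrite mulr0.
  by rewrite mcoeff_eq0; apply: msize_mdeg_ge; apply: leq_trans (ud j) dm.
have := congr1 (fun w : 'rV__ => w 0 (enum_rank (BMultinom md))) vM.
rewrite !mxE => vM0; rewrite -[RHS]vM0; apply: eq_bigr => j _.
by rewrite mcoeffZ mxE enum_rankK.
Qed.

(** Write g(x) as a product of factors x - r. A power of [f] is a multiple of
    x - r modulo I, so from f^k g(x) in I the factors can be removed one by one,
    each at the cost of a power of [f]. *)
Lemma avoids_root I f x g : ideal I -> avoids I f ->
  (forall c, ~ avoids (adjoin I (x - c%:MP)) f) ->
  g != 0 -> ~ exists k, I (f ^+ k * horner_alg x g).
Proof.
move=> [I0 ID IM] fI noc g0 [k].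
have [rs gE] := closed_field_poly_normal g.
have : lead_coef g != 0 by rewrite lead_coef_eq0.
move: (lead_coef g) gE => l {g0}-> l0; rewrite linearZ /= mulr_algl => Ifg.
have {}Ifg : I (f ^+ k * horner_alg x (\prod_(z <- rs) ('X - z%:P))).
  have := IM _ (l^-1)%:MP Ifg; rewrite -scalerAr mulrC mul_mpolyC scalerA (mulVf l0).
  by rewrite scale1r.
elim: rs k Ifg => [|r rs IH] k.
  by rewrite big_nil rmorph1 mulr1; apply: fI.
rewrite big_cons rmorphM rmorphB /= horner_algX horner_algC alg_mpolyC => Ifg.
have /existsNP[k' /contrapT[u Iu]] := noc r.
apply: (IH (k + k')%N); move: (horner_alg _ _) Ifg => w Ifg.
have -> : f ^+ (k + k') * w = (f ^+ k' - u * (x - r%:MP)) * (f ^+ k * w) +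
   (f ^+ k * ((x - r%:MP) * w)) * u by rewrite exprD; ring.
by apply: ID; apply: IM.
Qed.

(** If there were no such c, each c would give an inverse u / f^k of x - c
    modulo I. Some pair (k, size of u) occurs for infinitely many c, so that
    the corresponding u are linearly dependent; clearing denominators in the
    dependency yields a nonzero polynomial relation on x, against
    [avoids_root]. *)
Lemma avoids_adjoin I f x : ~ countable [set: F] -> ideal I -> avoids I f ->
  exists c, avoids (adjoin I (x - c%:MP)) f.
Proof.
move=> uncF idI fI; apply: contrapT => /forallNP noc.
have /choice[ku kuP] : forall c, exists ku : nat * A,
    I (f ^+ ku.1 - ku.2 * (x - c%:MP)).
  by move=> c; have /existsNP[k /contrapT[u Iu]] := noc c; exists (k, u).
have [[k d] /infinite_set_fset] :=
  uncountable_infinite_fiber (fun c => ((ku c).1, msize (ku c).2)) uncF.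
set N := #|{: 'X_{1..n < d}}| => /(_ N.+1)[B Bfib Nsz].
set s := finmap.enum_fset B in Nsz.
have us : uniq s by apply: finmap.fset_uniq.
pose c (j : 'I_N.+1) := s`_j.
have kuc j : (ku (c j)).1 = k /\ msize (ku (c j)).2 = d.
  have /Bfib[] : [set` B] (c j) by apply/mem_nth/(leq_trans (ltn_ord j)).
  by [].
have [l [j0 lj0] sum0] :
    exists2 l : 'I_N.+1 -> F, exists j, l j != 0 & \sum_j l j *: (ku (c j)).2 = 0.
  by apply: bounded_lin_dep => j; rewrite (kuc j).2.
(* The dependency with denominators cleared: g (c j) is l j times a nonzero
   product of differences. *)
pose g : {poly F} := \sum_j l j *: \prod_(i | i != j) ('X - (c i)%:P).
apply: (@avoids_root I f x g) => //.
  apply: contra_neq lj0 => /(congr1 (horner_eval (c j0))).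
  rewrite /g rmorph0 linear_sum (bigD1 j0) //= [X in _ + X]big1 => [|j jj0].
    rewrite addr0 /horner_eval hornerZ horner_prod => /eqP.
    rewrite mulf_eq0 => /orP[/eqP //|/prodf_eq0[i ij0]].
    rewrite !hornerE subr_eq0 /c nth_uniq // ?(leq_trans (ltn_ord _)) //.
    by move=> /eqP /val_inj ij; rewrite ij eqxx in ij0.
  rewrite /horner_eval hornerZ horner_prod (bigD1 j0) 1?eq_sym //=.
  by rewrite hornerXsubC subrr mul0r mulr0.
exists k; rewrite /g linear_sum /=.
case: idI => I0 ID IM.
pose w j := horner_alg x (\prod_(i | i != j) ('X - (c i)%:P)).
have wj j : (x - (c j)%:MP) * w j = horner_alg x (\prod_i ('X - (c i)%:P)).
  rewrite [in RHS](bigD1 j) //= rmorphM rmorphB /= horner_algX horner_algC.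
  by rewrite alg_mpolyC.
have -> : f ^+ k * (\sum_j horner_alg x (l j *: \prod_(i | i != j) ('X - (c i)%:P)))
  = \sum_j (f ^+ k - (ku (c j)).2 * (x - (c j)%:MP)) * (l j *: w j).
  rewrite mulr_sumr [RHS](eq_bigr (fun j => f ^+ k * (l j *: w j) -
    horner_alg x (\prod_i ('X - (c i)%:P)) * (l j *: (ku (c j)).2))); last first.
    move=> j _; rewrite mulrBl -(wj j) -!mul_mpolyC; congr (_ - _); ring.
  rewrite big_split /= sumrN -[X in _ - X]mulr_sumr sum0 mulr0 subr0.
  by apply: eq_bigr => j _; rewrite linearZ /= mulr_algl.
apply: (big_ind I) => // j _; apply: IM.
by have := kuP (c j); rewrite (kuc j).1.
Qed.

(** Specialize the variables one by one, keeping the powers of [f] out of the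
    ideal; what is left at the end is the ideal of a point. *)
Theorem nullstellensatz I f : ~ countable [set: F] -> ideal I -> avoids I f ->
  exists c : 'I_n -> F, (forall p, I p -> p.@[c] = 0) /\ f.@[c] != 0.
Proof.
move=> uncF idI fI.
have [c [J [idJ fJ IJ Jc]]] : exists c : 'I_n -> F, exists J,
    [/\ ideal J, avoids J f, I `<=` J &
        forall i, i \in enum 'I_n -> J ('X_i - (c i)%:MP)].
  elim: (enum 'I_n) => [|i s [c [J [idJ fJ IJ Jc]]]].
    by exists (fun=> 0), I; split.
  have [d fJ'] := avoids_adjoin 'X_i uncF idJ fJ.
  have [J0 JD JM] := idJ.
  exists (fun j => if j == i then d else c j), (adjoin J ('X_i - d%:MP)); split=> //.
  - exact: adjoin_ideal.
  - by move=> p /IJ Jp; exists 0; rewrite mul0r subr0.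
  - move=> j; rewrite inE; case: eqVneq => [-> _|_ /= /Jc Jj].
      by exists 1; rewrite mul1r subrr.
    by exists 0; rewrite mul0r subr0.
have [J0 JD JM] := idJ.
have JB p q : J p -> J q -> J (p - q).
  by move=> Jp Jq; rewrite -mulrN1; apply: JD => //; apply: JM.
pose S := [set p : A | J (p - p.@[c]%:MP)].
have SM p q : S p -> S q -> S (p * q).
  rewrite /S /= mevalM mpolyCM => Sp Sq.
  have -> : p * q - p.@[c]%:MP * q.@[c]%:MP =
    (p - p.@[c]%:MP) * q + (q - q.@[c]%:MP) * p.@[c]%:MP by ring.
  by apply: JD; apply: JM.
have SC b : S b%:MP by rewrite /S /= mevalC subrr.
have SX i : S 'X_i by rewrite /S /= mevalXU; apply/Jc/mem_enum.
have allS p : S p.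
  elim/mpolyind: p => [|b m p _ _ Sp].
    by rewrite -mpolyC0.
  have Sm : S (b *: 'X_[m]).
    rewrite -mul_mpolyC mpolyXE_id; apply: (SM _ _) => //.
    apply: (big_ind S) => [|p1 p2|i _]; [by rewrite -mpolyC1|by apply: SM|].
    elim: (m i) => [|k IHk]; first by rewrite expr0 -mpolyC1.
    by rewrite exprS; apply: (SM _ _).
  by rewrite /S /= mevalD mpolyCD opprD addrACA; apply: JD.
have ev0 p : J p -> p.@[c] = 0.
  move=> Jp; apply: contrapT => /eqP pc0; apply: (fJ 0%N); rewrite expr0.
  have Jpc : J (p.@[c]%:MP) by rewrite -[_%:MP](subKr p); apply: JB => //; apply: allS.
  have := JM _ (p.@[c]^-1)%:MP Jpc; by rewrite -mpolyCM mulfV // mpolyC1.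
exists c; split; first by move=> p /IJ /ev0.
apply/eqP => fc; apply: (fJ 1%N); rewrite expr1.
by have := allS f; rewrite /S /= fc mpolyC0 subr0.
Qed.

End Nullstellensatz.

(** * Real polynomials at complex points *)

Lemma complex_ReD (R : realType) (x y : R[i]) : Re (x + y) = Re x + Re y.
Proof. by case: x => ? ?; case: y. Qed.
Lemma complex_ImD (R : realType) (x y : R[i]) : Im (x + y) = Im x + Im y.
Proof. by case: x => ? ?; case: y. Qed.
Lemma complex_ReN (R : realType) (x : R[i]) : Re (- x) = - Re x. Proof. by case: x. Qed.
Lemma complex_ImN (R : realType) (x : R[i]) : Im (- x) = - Im x. Proof. by case: x. Qed.
Lemma complex_ReM (R : realType) (x y : R[i]) : Re (x * y) = Re x * Re y - Im x * Im y.
Proof. by case: x => ? ?; case: y. Qed.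
Lemma complex_ImM (R : realType) (x y : R[i]) : Im (x * y) = Re x * Im y + Im x * Re y.
Proof. by case: x => ? ?; case: y. Qed.

Section RealNullstellensatz.

Variables (R : realType) (n : nat).
Local Notation C := R[i].
Local Notation A := {mpoly R[n]}.

(** New names, so that the projections carry an additive structure on R[i]. *)
Definition reC (x : C) := Re x.
Definition imC (x : C) := Im x.
Lemma reC_zmod : zmod_morphism reC.
Proof. by move=> x y; rewrite /reC complex_ReD complex_ReN. Qed.
Lemma imC_zmod : zmod_morphism imC.
Proof. by move=> x y; rewrite /imC complex_ImD complex_ImN. Qed.
HB.instance Definition _ := GRing.isZmodMorphism.Build C R reC reC_zmod.
HB.instance Definition _ := GRing.isZmodMorphism.Build C R imC imC_zmod.

Definition ceval (z : 'I_n -> C) (p : A) : C := (map_mpoly (real_complex R) p).@[z].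

HB.instance Definition _ z :=
  GRing.RMorphism.copy (ceval z) (meval z \o map_mpoly (real_complex R)).

Lemma map_reCM (p q : {mpoly C[n]}) : map_mpoly reC (p * q) =
  map_mpoly reC p * map_mpoly reC q - map_mpoly imC p * map_mpoly imC q.
Proof.
apply/mpolyP => m; rewrite mcoeffB !mcoeffM mcoeff_map_mpoly mcoeffM raddf_sum.
by rewrite -sumrB; apply: eq_bigr => k _; rewrite !mcoeff_map_mpoly; apply: complex_ReM.
Qed.

Lemma map_imCM (p q : {mpoly C[n]}) : map_mpoly imC (p * q) =
  map_mpoly reC p * map_mpoly imC q + map_mpoly imC p * map_mpoly reC q.
Proof.
apply/mpolyP => m; rewrite mcoeffD !mcoeffM mcoeff_map_mpoly mcoeffM raddf_sum.
by rewrite -big_split; apply: eq_bigr => k _; rewrite !mcoeff_map_mpoly; apply: complex_ImM.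
Qed.

Lemma map_reC_real (p : A) : map_mpoly reC (map_mpoly (real_complex R) p) = p.
Proof. by apply/mpolyP => m; rewrite !mcoeff_map_mpoly. Qed.

Lemma map_imC_real (p : A) : map_mpoly imC (map_mpoly (real_complex R) p) = 0.
Proof. by apply/mpolyP => m; rewrite !mcoeff_map_mpoly mcoeff0. Qed.

Lemma complex_uncountable : ~ countable [set: C].
Proof.
move=> /countable_injP[f finj]; apply: (real_uncountable (R := R)).
apply/countable_injP; exists (f \o real_complex R) => x y _ _ /= fxy.
by apply: complexI; apply: finj => //; apply: mem_set.
Qed.

(** The complex polynomials whose real and imaginary parts lie in I form an
    ideal with the same real elements as I. *)
Theorem real_nullstellensatz (I : set A) (f : A) : ideal I -> avoids I f ->
  exists z : 'I_n -> C, (forall p, I p -> ceval z p = 0) /\ ceval z f != 0.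
Proof.
move=> [I0 ID IM] fI.
have IN p : I p -> I (- p) by move=> Ip; rewrite -mulrN1; apply: IM.
pose J := [set P : {mpoly C[n]} | I (map_mpoly reC P) /\ I (map_mpoly imC P)].
have idJ : ideal J.
  split; first by rewrite /J /= !raddf0.
    by move=> p q [? ?] [? ?]; rewrite /J /= !raddfD; split; apply: ID.
  move=> p q [? ?]; rewrite /J /= map_reCM map_imCM.
  by split; apply: (ID); try apply: (IN); apply: IM.
have fJ : avoids J (map_mpoly (real_complex R) f).
  by move=> k [+ _]; rewrite -rmorphXn map_reC_real; apply: fI.
have [z [zJ zf]] := nullstellensatz complex_uncountable idJ fJ.
exists z; split=> // p Ip; apply: zJ.
by rewrite /J /= map_reC_real map_imC_real.
Qed.

End RealNullstellensatz.

(** * Quaternions *)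

Section Quat.
Variable R : realFieldType.
Implicit Types (x y J : quat R).

Lemma conjqM x y : conjq (x * y) = conjq y * conjq x.
Proof. by case: x => ????; case: y => ????; congr Quat => /=; ring. Qed.

Lemma normq2M x y : normq2 (x * y) = normq2 x * normq2 y.
Proof. by case: x => ????; case: y => ????; rewrite /normq2 /=; ring. Qed.

Lemma normq2_conj x : normq2 (conjq x) = normq2 x.
Proof. by case: x => ????; rewrite /normq2 /=; ring. Qed.

Lemma imag_unit_conj J : J * J = -1 -> conjq J = - J.
Proof.
case: J => a b c d [e0 e1 e2 e3]; congr Quat => /=.
suff: a = 0 by lra.
apply/eqP; apply: contraT => a0.
have h u : a * u + u * a = 0 -> u = 0.
  by rewrite [u * a]mulrC => hu; apply: (mulfI a0); rewrite mulr0; lra.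
have b0 : b = 0 by apply: h; lra.
have c0 : c = 0 by apply: h; lra.
have d0 : d = 0 by apply: h; lra.
by move: e0 (sqr_ge0 a); rewrite b0 c0 d0 expr2; lra.
Qed.

Lemma third_imag_unit J1 J2 : exists J, [/\ J * J = -1, J != J1 & J != J2].
Proof.
pose i : quat R := Quat 0 1 0 0; pose j : quat R := Quat 0 0 1 0.
pose k : quat R := Quat 0 0 0 1.
have [ii jj kk] : [/\ i * i = -1, j * j = -1 & k * k = -1].
  by split; congr Quat => /=; ring.
have n10 : 1 <> 0 :> R by apply/eqP/oner_neq0.
have [ij ik jk] : [/\ i <> j, i <> k & j <> k] by split=> -[*]; apply: n10.
have [|hi] := boolP ((i != J1) && (i != J2)); first by case/andP; exists i.
have [|hj] := boolP ((j != J1) && (j != J2)); first by case/andP; exists j.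
have [|hk] := boolP ((k != J1) && (k != J2)); first by case/andP; exists k.
exfalso; case/nandP: hi => /negPn/eqP hi; case/nandP: hj => /negPn/eqP hj;
by case/nandP: hk => /negPn/eqP hk; congruence.
Qed.

Lemma pure_sqr x : qre x = 0 -> x * x = - realq (normq2 x).
Proof.
by case: x => a b c d /= ->; rewrite /normq2; congr Quat => /=; ring.
Qed.

(** The last two hypotheses say that x + i y is a zero divisor of the complexified
    quaternions, where the norm is |x|^2 - |y|^2 + 2 i Re(x y^c); such an
    element vanishes when i is replaced by a suitable imaginary unit on the
    left. *)
Lemma isotropic_imag_unit x y : y != 0 -> normq2 x = normq2 y ->
  qre (x * conjq y) = 0 -> (- x * y^-1) * (- x * y^-1) = -1.
Proof.
move=> y0 Nxy pure; rewrite mulNr mulrNN.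
have -> : x * y^-1 = scaleq (normq2 y)^-1 (x * conjq y).
  have -> : y^-1 = scaleq (normq2 y)^-1 (conjq y) by [].
  move: (normq2 y)^-1 (conjq y) => r; case: x {Nxy pure} => ???? [????].
  by congr Quat => /=; ring.
move: (x * conjq y) pure (normq2M x (conjq y)) => w pure.
rewrite normq2_conj Nxy => Nw.
have -> : scaleq (normq2 y)^-1 w * scaleq (normq2 y)^-1 w =
    scaleq ((normq2 y)^-1 ^+ 2) (w * w).
  by case: w {pure Nw} => ????; congr Quat => /=; ring.
rewrite (pure_sqr pure) Nw; have : normq2 y != 0 by rewrite normq2_eq0.
by move: (normq2 y) => r r0; congr Quat => /=; field.
Qed.

End Quat.

(** * Real components of slice regular polynomials *)

Section Components.

Variables (R : realType) (n : nat).
Local Notation H := (quat R).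
Local Notation C := R[i].
Local Notation A := {mpoly R[n]}.
Implicit Types (P Q : {mpoly H[n]}) (f : A) (z : 'I_n -> C).

Lemma qre_is_zmod : zmod_morphism (@qre R). Proof. by move=> [????] []. Qed.
Lemma qi_zmod : zmod_morphism (@qi R). Proof. by move=> [????] []. Qed.
Lemma qj_zmod : zmod_morphism (@qj R). Proof. by move=> [????] []. Qed.
Lemma qk_zmod : zmod_morphism (@qk R). Proof. by move=> [????] []. Qed.
HB.instance Definition _ := GRing.isZmodMorphism.Build H R (@qre R) qre_is_zmod.
HB.instance Definition _ := GRing.isZmodMorphism.Build H R (@qi R) qi_zmod.
HB.instance Definition _ := GRing.isZmodMorphism.Build H R (@qj R) qj_zmod.
HB.instance Definition _ := GRing.isZmodMorphism.Build H R (@qk R) qk_zmod.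

Lemma realq_zmod : zmod_morphism (@realq R).
Proof. by move=> x y; congr Quat; rewrite /= subrr. Qed.
Lemma realq_monoid : monoid_morphism (@realq R).
Proof. by split=> // x y; congr Quat => /=; ring. Qed.
HB.instance Definition _ := GRing.isZmodMorphism.Build R H (@realq R) realq_zmod.
HB.instance Definition _ := GRing.isMonoidMorphism.Build R H (@realq R) realq_monoid.

Lemma realqC (r : R) (q : H) : realq r * q = q * realq r.
Proof. by case: q => a b c d; congr Quat => /=; ring. Qed.

Definition poly_re P : A := map_mpoly (@qre R) P.
Definition poly_i P : A := map_mpoly (@qi R) P.
Definition poly_j P : A := map_mpoly (@qj R) P.
Definition poly_k P : A := map_mpoly (@qk R) P.
Definition poly_real f : {mpoly H[n]} := map_mpoly (@realq R) f.

Lemma components_eq P Q :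
  poly_re P = poly_re Q -> poly_i P = poly_i Q -> poly_j P = poly_j Q ->
  poly_k P = poly_k Q -> P = Q.
Proof.
move=> /mpolyP e0 /mpolyP e1 /mpolyP e2 /mpolyP e3; apply/mpolyP => m.
move: (e0 m) (e1 m) (e2 m) (e3 m); rewrite !mcoeff_map_mpoly.
by case: (P@_m) (Q@_m) => [????] [????] /= -> -> -> ->.
Qed.

Let compE := (mcoeffD, mcoeffB, mcoeffN, mcoeffM, mcoeff_map_mpoly).

Lemma poly_reM P Q :
  poly_re (P * Q) =
    poly_re P * poly_re Q - poly_i P * poly_i Q - poly_j P * poly_j Q - poly_k P * poly_k Q.
Proof.
apply/mpolyP => m; rewrite !compE raddf_sum -!sumrB.
by apply: eq_bigr => k _; rewrite !mcoeff_map_mpoly.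
Qed.

Lemma poly_iM P Q :
  poly_i (P * Q) =
    poly_re P * poly_i Q + poly_i P * poly_re Q + poly_j P * poly_k Q - poly_k P * poly_j Q.
Proof.
apply/mpolyP => m; rewrite !compE raddf_sum -!big_split -sumrB.
by apply: eq_bigr => k _; rewrite !mcoeff_map_mpoly.
Qed.

Lemma poly_jM P Q :
  poly_j (P * Q) =
    poly_re P * poly_j Q - poly_i P * poly_k Q + poly_j P * poly_re Q + poly_k P * poly_i Q.
Proof.
apply/mpolyP => m; rewrite !compE raddf_sum -sumrB -!big_split.
by apply: eq_bigr => k _; rewrite !mcoeff_map_mpoly.
Qed.

Lemma poly_kM P Q :
  poly_k (P * Q) =
    poly_re P * poly_k Q + poly_i P * poly_j Q - poly_j P * poly_i Q + poly_k P * poly_re Q.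
Proof.
apply/mpolyP => m; rewrite !compE raddf_sum -!big_split -sumrB -!big_split.
by apply: eq_bigr => k _; rewrite !mcoeff_map_mpoly.
Qed.

Lemma components_real f :
  [/\ poly_re (poly_real f) = f, poly_i (poly_real f) = 0,
      poly_j (poly_real f) = 0 & poly_k (poly_real f) = 0].
Proof. by split; apply/mpolyP => m; rewrite !mcoeff_map_mpoly ?mcoeff0. Qed.

Lemma components_const (q : H) :
  [/\ poly_re q%:MP = (qre q)%:MP, poly_i q%:MP = (qi q)%:MP,
      poly_j q%:MP = (qj q)%:MP & poly_k q%:MP = (qk q)%:MP].
Proof. by split; apply: map_mpolyC. Qed.

Lemma components_rconj P :
  [/\ poly_re (rconj P) = poly_re P, poly_i (rconj P) = - poly_i P,
      poly_j (rconj P) = - poly_j P & poly_k (rconj P) = - poly_k P].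
Proof. by split; apply/mpolyP => m; rewrite ?mcoeffN !mcoeff_map_mpoly. Qed.

Lemma poly_realC f P : poly_real f * P = P * poly_real f.
Proof.
have [e0 e1 e2 e3] := components_real f.
by apply: components_eq; rewrite !(poly_reM, poly_iM, poly_jM, poly_kM);
  rewrite e0 e1 e2 e3; ring.
Qed.

Lemma components_decomp P :
  P = poly_real (poly_re P) + poly_real (poly_i P) * (Quat 0 1 0 0)%:MP +
      poly_real (poly_j P) * (Quat 0 0 1 0)%:MP +
      poly_real (poly_k P) * (Quat 0 0 0 1)%:MP.
Proof.
have rpc f c m : (poly_real f * c%:MP)@_m = c * realq f@_m.
  by rewrite poly_realC mcoeffCM mcoeff_map_mpoly.
apply/mpolyP => m; rewrite !mcoeffD !rpc [(poly_real _)@_m]mcoeff_map_mpoly.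
rewrite !mcoeff_map_mpoly.
by case: P@_m => a b c d; congr Quat => /=; ring.
Qed.

Definition poly_norm P : A :=
  poly_re P ^+ 2 + poly_i P ^+ 2 + poly_j P ^+ 2 + poly_k P ^+ 2.

Lemma symm_poly_norm P : symm P = poly_real (poly_norm P).
Proof.
have [e0 e1 e2 e3] := components_rconj P.
have [f0 f1 f2 f3] := components_real (poly_norm P).
by apply: components_eq; rewrite ?f0 ?f1 ?f2 ?f3 /symm;
  rewrite !(poly_reM, poly_iM, poly_jM, poly_kM) e0 e1 e2 e3 /poly_norm; ring.
Qed.

(** [ev_re z P] + i [ev_im z P] is the value of P at z in the complexified
    quaternions; both parts are kept as quaternions. *)
Definition ev_re z P : H :=
  Quat (Re (ceval z (poly_re P))) (Re (ceval z (poly_i P)))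
       (Re (ceval z (poly_j P))) (Re (ceval z (poly_k P))).
Definition ev_im z P : H :=
  Quat (Im (ceval z (poly_re P))) (Im (ceval z (poly_i P)))
       (Im (ceval z (poly_j P))) (Im (ceval z (poly_k P))).

Lemma cevalD z f g : ceval z (f + g) = ceval z f + ceval z g.
Proof. exact: rmorphD. Qed.
Lemma cevalB z f g : ceval z (f - g) = ceval z f - ceval z g.
Proof. exact: rmorphB. Qed.
Lemma cevalN z f : ceval z (- f) = - ceval z f. Proof. exact: rmorphN. Qed.
Lemma cevalM z f g : ceval z (f * g) = ceval z f * ceval z g.
Proof. exact: rmorphM. Qed.

Lemma ev_reM z P Q : ev_re z (P * Q) = ev_re z P * ev_re z Q - ev_im z P * ev_im z Q.
Proof.
rewrite /ev_re /ev_im poly_reM poly_iM poly_jM poly_kM.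
move: (poly_re P) (poly_i P) (poly_j P) (poly_k P).
move: (poly_re Q) (poly_i Q) (poly_j Q) (poly_k Q).
move=> q0 q1 q2 q3 p0 p1 p2 p3; rewrite !cevalD !cevalN !cevalM.
move: (ceval z p0) (ceval z p1) (ceval z p2) (ceval z p3).
move: (ceval z q0) (ceval z q1) (ceval z q2) (ceval z q3).
by do 8![move=> [? ?]]; congr Quat => /=; ring.
Qed.

Lemma ev_imM z P Q : ev_im z (P * Q) = ev_re z P * ev_im z Q + ev_im z P * ev_re z Q.
Proof.
rewrite /ev_re /ev_im poly_reM poly_iM poly_jM poly_kM.
move: (poly_re P) (poly_i P) (poly_j P) (poly_k P).
move: (poly_re Q) (poly_i Q) (poly_j Q) (poly_k Q).
move=> q0 q1 q2 q3 p0 p1 p2 p3; rewrite !cevalD !cevalN !cevalM.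
move: (ceval z p0) (ceval z p1) (ceval z p2) (ceval z p3).
move: (ceval z q0) (ceval z q1) (ceval z q2) (ceval z q3).
by do 8![move=> [? ?]]; congr Quat => /=; ring.
Qed.

End Components.

(** * Values on a sphere *)

Section Points.

Variables (R : realType) (n : nat).
Local Notation H := (quat R).
Local Notation C := R[i].
Local Notation A := {mpoly R[n]}.
Local Notation slpoly := {mpoly H[n]}.
Implicit Types (P Q : slpoly) (I : set slpoly) (f : A) (z : 'I_n -> C) (J : H) (c : C).

Definition slice_map J c : H := realq (Re c) + realq (Im c) * J.
Definition slice_pt J z : 'I_n -> H := fun i => slice_map J (z i).

Lemma slice_map1 J : slice_map J 1 = 1.
Proof. by rewrite /slice_map /= rmorph0 mul0r addr0 rmorph1. Qed.

Lemma slice_mapM J : J * J = -1 -> {morph slice_map J : c d / c * d}.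
Proof.
move=> JJ c d; rewrite /slice_map complex_ReM complex_ImM.
rewrite rmorphB rmorphD !rmorphM /=.
move: (Re c) (Im c) (Re d) (Im d) => x y u v.
have e1 : realq y * J * realq u = realq y * realq u * J.
  by rewrite -mulrA -realqC mulrA.
have e2 : realq y * J * (realq v * J) = - (realq y * realq v).
  by rewrite mulrA -[_ * J * _]mulrA -realqC mulrA -mulrA JJ mulrN1.
rewrite mulrDl [RHS]mulrDl !mulrDr e1 e2 mulrA -!addrA; congr (_ + _).
by rewrite addrC -addrA.
Qed.

Lemma slice_map_mul J c (q : H) :
  slice_map J c * q = realq (Re c) * q + J * (realq (Im c) * q).
Proof. by rewrite /slice_map mulrDl realqC [realq (Im c) * J]realqC -mulrA realqC. Qed.

Lemma ceval_map (phi : {additive H -> R}) z P : ceval z (map_mpoly phi P) =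
  \sum_(m <- msupp P) (phi P@_m)%:C%C * \prod_i z i ^+ m i.
Proof.
rewrite /map_mpoly /mmap rmorph_sum /=; apply: eq_bigr => m _.
by rewrite cevalM mmap1_id /ceval map_mpolyC map_mpolyX mevalC mevalX.
Qed.

Lemma ev_reE z P : ev_re z P =
  \sum_(m <- msupp P) realq (Re (\prod_i z i ^+ m i)) * P@_m.
Proof.
have addRe (phi : {additive H -> R}) :
    (forall r q, phi (realq r * q) = r * phi q) ->
    Re (ceval z (map_mpoly phi P)) =
    phi (\sum_(m <- msupp P) realq (Re (\prod_i z i ^+ m i)) * P@_m).
  move=> phiZ; rewrite ceval_map raddf_sum -/(reC _) raddf_sum; apply: eq_bigr => m _.
  by rewrite phiZ [RHS]mulrC; apply: etrans (complex_ReM _ _) _; rewrite /= mul0r subr0.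
set S := \sum_(_ <- _) _ in addRe *.
suff -> : ev_re z P = Quat (qre S) (qi S) (qj S) (qk S) by case: S {addRe}.
by congr Quat; apply: addRe => r [????] /=; ring.
Qed.

Lemma ev_imE z P : ev_im z P =
  \sum_(m <- msupp P) realq (Im (\prod_i z i ^+ m i)) * P@_m.
Proof.
have addIm (phi : {additive H -> R}) :
    (forall r q, phi (realq r * q) = r * phi q) ->
    Im (ceval z (map_mpoly phi P)) =
    phi (\sum_(m <- msupp P) realq (Im (\prod_i z i ^+ m i)) * P@_m).
  move=> phiZ; rewrite ceval_map raddf_sum -/(imC _) raddf_sum; apply: eq_bigr => m _.
  by rewrite phiZ [RHS]mulrC; apply: etrans (complex_ImM _ _) _; rewrite /= mul0r addr0.
set S := \sum_(_ <- _) _ in addIm *.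
suff -> : ev_im z P = Quat (qre S) (qi S) (qj S) (qk S) by case: S {addIm}.
by congr Quat; apply: addIm => r [????] /=; ring.
Qed.

(** On a slice the ordered powers of the coordinates multiply as complex
    numbers do, so the value of P depends on J through one left factor only. *)
Lemma sleval_slice_pt J z P : J * J = -1 ->
  sleval P (slice_pt J z) = ev_re z P + J * ev_im z P.
Proof.
move=> JJ; rewrite ev_reE ev_imE mulr_sumr -big_split; apply: eq_bigr => m _ /=.
rewrite -slice_map_mul; congr (_ * _).
rewrite (big_morph (slice_map J) (slice_mapM JJ) (slice_map1 J)).
apply: eq_bigr => i _; rewrite /slice_pt.
elim: (m i) => [|k IH]; first by rewrite !expr0 slice_map1.
by rewrite !exprS slice_mapM // IH.
Qed.

(** By [sleval_slice_pt], the common zeros of I among the points [slice_pt J z]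
    when J is an imaginary unit. *)
Definition zeros_at I J z : Prop := forall P, I P -> ev_re z P + J * ev_im z P = 0.

Lemma Vc_slice_pt I J z : J * J = -1 -> Vc I (slice_pt J z) <-> zeros_at I J z.
Proof.
move=> JJ; split=> [[VI _] P IP|ZI]; first by rewrite -sleval_slice_pt // VI.
split=> [P IP|]; first by rewrite sleval_slice_pt // ZI.
exists J => [|i]; first by rewrite /imag_units /= expr2.
by exists (Re (z i)), (Im (z i)).
Qed.

Lemma Vc_in_slice I a : Vc I a -> exists J z, J * J = -1 /\ a = slice_pt J z.
Proof.
move=> [_ [J]]; rewrite /imag_units /= expr2 => JJ aJ.
have /choice[x /choice[y axy]] : forall i, exists x y, a i = realq x + realq y * J.
  exact: aJ.
by exists J, (fun i => Complex (x i) (y i)); split=> //; apply: funext.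
Qed.

Lemma ev_re_real z f : ev_re z (poly_real f) = realq (Re (ceval z f)).
Proof.
by rewrite /ev_re; have [-> -> -> ->] := components_real f; rewrite /ceval !rmorph0.
Qed.

Lemma ev_im_real z f : ev_im z (poly_real f) = realq (Im (ceval z f)).
Proof.
by rewrite /ev_im; have [-> -> -> ->] := components_real f; rewrite /ceval !rmorph0.
Qed.

Lemma cevalC z (r : R) : ceval z r%:MP = r%:C%C.
Proof. by rewrite /ceval map_mpolyC mevalC. Qed.

Lemma ev_re_const z (q : H) : ev_re z q%:MP = q.
Proof.
by rewrite /ev_re; have [-> -> -> ->] := components_const n q; rewrite !cevalC; case: q.
Qed.

Lemma ev_im_const z (q : H) : ev_im z q%:MP = 0.
Proof. by rewrite /ev_im; have [-> -> -> ->] := components_const n q; rewrite !cevalC. Qed.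

Lemma ev_re_rconj z P : ev_re z (rconj P) = conjq (ev_re z P).
Proof.
rewrite /ev_re; have [-> -> -> ->] := components_rconj P.
move: (poly_re P) (poly_i P) (poly_j P) (poly_k P) => p0 p1 p2 p3.
by congr Quat; rewrite cevalN complex_ReN.
Qed.

Lemma ev_im_rconj z P : ev_im z (rconj P) = conjq (ev_im z P).
Proof.
rewrite /ev_im; have [-> -> -> ->] := components_rconj P.
move: (poly_re P) (poly_i P) (poly_j P) (poly_k P) => p0 p1 p2 p3.
by congr Quat; rewrite cevalN complex_ImN.
Qed.

Lemma ev_reB z P Q : ev_re z (P - Q) = ev_re z P - ev_re z Q.
Proof.
rewrite /ev_re /poly_re /poly_i /poly_j /poly_k !raddfB /=.
rewrite -!/(poly_re _) -!/(poly_i _) -!/(poly_j _) -!/(poly_k _).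
move: (poly_re P) (poly_i P) (poly_j P) (poly_k P).
move: (poly_re Q) (poly_i Q) (poly_j Q) (poly_k Q) => *.
by congr Quat; rewrite cevalB complex_ReD complex_ReN.
Qed.

Lemma ev_imB z P Q : ev_im z (P - Q) = ev_im z P - ev_im z Q.
Proof.
rewrite /ev_im /poly_re /poly_i /poly_j /poly_k !raddfB /=.
rewrite -!/(poly_re _) -!/(poly_i _) -!/(poly_j _) -!/(poly_k _).
move: (poly_re P) (poly_i P) (poly_j P) (poly_k P).
move: (poly_re Q) (poly_i Q) (poly_j Q) (poly_k Q) => *.
by congr Quat; rewrite cevalB complex_ImD complex_ImN.
Qed.

Lemma ev_eq0P z P : (ev_re z P = 0 /\ ev_im z P = 0) <->
  [/\ ceval z (poly_re P) = 0, ceval z (poly_i P) = 0,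
      ceval z (poly_j P) = 0 & ceval z (poly_k P) = 0].
Proof.
rewrite /ev_re /ev_im; move: (ceval z (poly_re P)) (ceval z (poly_i P)).
move: (ceval z (poly_j P)) (ceval z (poly_k P)).
move=> [a0 b0] [a1 b1] [a2 b2] [a3 b3] /=.
by split=> [[[-> -> -> ->] [-> -> -> ->]]|[[-> ->] [-> ->] [-> ->] [-> ->]]].
Qed.

(** Used for the two parts a and b of a polynomial at z: two zeros on a sphere
    force the polynomial to vanish on all of it. *)
Lemma two_zeros (J J' a b : H) : J != J' -> a + J * b = 0 -> a + J' * b = 0 ->
  a = 0 /\ b = 0.
Proof.
move=> JJ' e e'; have : (J - J') * b = 0.
  by rewrite mulrBl -[J * b](addKr a) -[J' * b](addKr a) e e' subrr.
move=> /(congr1 ( *%R (J - J')^-1)); rewrite mulr0 mulrA mulVr ?unitqE ?subr_eq0 //.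
by rewrite mul1r => b0; move: e; rewrite b0 mulr0 addr0.
Qed.

(** Since i is central, replacing i by J on the left commutes with right
    multiplications. *)
Lemma zero_at_mulr J z P Q : J * J = -1 -> ev_re z P + J * ev_im z P = 0 ->
  ev_re z (P * Q) + J * ev_im z (P * Q) = 0.
Proof.
move=> JJ zP; rewrite ev_reM ev_imM.
have -> : ev_re z P * ev_re z Q - ev_im z P * ev_im z Q +
    J * (ev_re z P * ev_im z Q + ev_im z P * ev_re z Q) =
    (ev_re z P + J * ev_im z P) * ev_re z Q + J * ((ev_re z P + J * ev_im z P) * ev_im z Q).
  move: (ev_re z P) (ev_im z P) (ev_re z Q) (ev_im z Q) => a b c d.
  rewrite !mulrDl !mulrDr !mulrA JJ mulN1r mulNr -!addrA; congr (_ + _).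
  by rewrite addrC [J * a * d + _]addrC -addrA.
by rewrite zP !mul0r mulr0 addr0.
Qed.

Lemma zero_at_mul_real J z P f : ceval z f = 0 ->
  ev_re z (P * poly_real f) + J * ev_im z (P * poly_real f) = 0.
Proof.
move=> f0; rewrite ev_reM ev_imM ev_re_real ev_im_real f0 rmorph0.
by rewrite !mulr0 subrr addr0 mulr0 addr0.
Qed.

Lemma zero_at_real J z f : J * J = -1 ->
  ev_re z (poly_real f) + J * ev_im z (poly_real f) = 0 -> ceval z f = 0.
Proof.
move=> JJ; rewrite ev_re_real ev_im_real -realqC => fJ.
apply/eqP; apply: contraT => f0; case/eqP: (@oner_neq0 H).
by rewrite -(slice_map1 J) -(mulfV f0) slice_mapM // [slice_map J _]fJ mul0r.
Qed.

Lemma poly_norm_eq0 z P : ceval z (poly_norm P) = 0 ->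
  normq2 (ev_re z P) = normq2 (ev_im z P) /\ qre (ev_re z P * conjq (ev_im z P)) = 0.
Proof.
rewrite /poly_norm /ev_re /ev_im.
move: (poly_re P) (poly_i P) (poly_j P) (poly_k P) => p0 p1 p2 p3.
rewrite !cevalD !expr2 !cevalM.
move: (ceval z p0) (ceval z p1) (ceval z p2) (ceval z p3).
move=> [a0 b0] [a1 b1] [a2 b2] [a3 b3] [e0 e1]; rewrite /normq2 /=; split.
  by move: e0; rewrite !expr2; lra.
by lra.
Qed.

(** An element of norm zero at z whose imaginary part there is not zero has just
    one zero on the sphere of z. Any other element vanishes at that point,
    because a combination of the two has imaginary part zero at z, and being
    of norm zero vanishes at z. *)
Lemma common_zero I z : right_ideal I ->
  (forall P, I P -> ceval z (poly_norm P) = 0) ->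
  exists J, J * J = -1 /\ zeros_at I J z.
Proof.
move=> [I0 ID IM] I_iso.
have IB P Q : I P -> I Q -> I (P - Q).
  by move=> IP IQ; rewrite -mulrN1; apply: ID => //; apply: IM.
have im0_re0 P : I P -> ev_im z P = 0 -> ev_re z P = 0.
  move=> IP imP; have [+ _] := poly_norm_eq0 (I_iso _ IP).
  by rewrite imP => /eqP; rewrite (_ : normq2 0 = 0) ?normq2_eq0;
    [move/eqP|apply/eqP; rewrite normq2_eq0].
have [[F [IF F0]]|allim0] := pselect (exists F, I F /\ ev_im z F != 0); last first.
  exists (Quat 0 1 0 0); split; first by congr Quat => /=; ring.
  move=> P IP; have imP : ev_im z P = 0.
    by apply/eqP; apply: contraT => imP; case: allim0; exists P.
  by rewrite imP mulr0 addr0; apply: im0_re0.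
have [eN e0] := poly_norm_eq0 (I_iso _ IF).
exists (- ev_re z F * (ev_im z F)^-1); split; first exact: isotropic_imag_unit.
move=> P IP; pose P' := F * ((ev_im z F)^-1 * ev_im z P)%:MP - P.
have imP' : ev_im z P' = 0.
  by rewrite /P' ev_imB ev_imM ev_re_const ev_im_const mulr0 add0r mulVKr ?subrr ?unitqE.
have /im0_re0/(_ imP') : I P' by apply: IB => //; apply: IM.
rewrite /P' ev_reB ev_reM ev_re_const ev_im_const mulr0 subr0 => /eqP; rewrite subr_eq0.
by move=> /eqP <-; rewrite -mulrA mulNr subrr.
Qed.

(** In the complexified quaternions the elements vanishing at J are the
    (i - J) b, their conjugates are the b^c (i + J), and
    (i + J) (i - J) = 0. *)
Lemma rconj_mul_vanishes J z P Q : J * J = -1 -> ev_re z P + J * ev_im z P = 0 ->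
  ev_re z Q + J * ev_im z Q = 0 -> ev_re z (rconj P * Q) = 0 /\ ev_im z (rconj P * Q) = 0.
Proof.
move=> JJ /eqP; rewrite addr_eq0 => /eqP zP /eqP; rewrite addr_eq0 => /eqP zQ.
have cP : conjq (ev_re z P) = conjq (ev_im z P) * J.
  have conjqN (q : H) : conjq (- q) = - conjq q by apply: raddfN.
  by rewrite zP conjqN conjqM (imag_unit_conj JJ) mulrN opprK.
rewrite ev_reM ev_imM ev_re_rconj ev_im_rconj cP zQ; split.
  by rewrite mulrN !mulrA -[_ * J * J]mulrA JJ mulrN1 mulNr opprK subrr.
by rewrite mulrN !mulrA subrr.
Qed.

Lemma zero_at_poly_norm J z P : J * J = -1 ->
  ev_re z P + J * ev_im z P = 0 -> ceval z (poly_norm P) = 0.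
Proof.
move=> JJ zP; apply: (zero_at_real JJ).
by rewrite -symm_poly_norm; apply: zero_at_mulr.
Qed.

Lemma poly_realD f g : poly_real (f + g) = poly_real f + poly_real g.
Proof. exact: raddfD. Qed.
Lemma poly_realM f g : poly_real (f * g) = poly_real f * poly_real g.
Proof. exact: rmorphM. Qed.
Lemma poly_real0 : poly_real (0 : A) = 0. Proof. exact: raddf0. Qed.
Lemma poly_real1 : poly_real (1 : A) = 1. Proof. exact: rmorph1. Qed.
Lemma componentsD P Q :
  [/\ poly_re (P + Q) = poly_re P + poly_re Q,
      poly_i (P + Q) = poly_i P + poly_i Q,
      poly_j (P + Q) = poly_j P + poly_j Q & poly_k (P + Q) = poly_k P + poly_k Q].
Proof. by split; apply: raddfD. Qed.

Local Opaque poly_real poly_re poly_i poly_j poly_k ceval.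

(** * Quasi prime radical ideals *)

Definition real_part I : set A := [set f | I (poly_real f)].

Definition components P : set A :=
  [set f | [\/ f = poly_re P, f = poly_i P, f = poly_j P | f = poly_k P]].

Section QuasiPrimeRadical.

Variable I : set slpoly.
Hypotheses (ideal_I : right_ideal I) (qp_I : quasi_prime I) (rad_I : is_radical I).

Lemma real_part_ideal : ideal (real_part I).
Proof.
case: ideal_I => I0 ID IM; split; rewrite /real_part /=.
- by rewrite poly_real0.
- by move=> f g If Ig; rewrite poly_realD; apply: ID.
- by move=> f g If; rewrite poly_realM; apply: IM.
Qed.

(** Real polynomials are central, so every completely prime ideal is stable
    under them and behaves as a prime ideal for them. *)
Lemma real_part_radical f k : real_part I (f ^+ k) -> real_part I f.
Proof.
move=> Ifk; rewrite /real_part /= -rad_I => J idJ cpJ IJ.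
have [J0 JD JM] := idJ.
have {Ifk} : J (poly_real (f ^+ k)) by apply: IJ.
elim: k => [|k IH].
  by rewrite expr0 poly_real1 => J1; rewrite -[poly_real f]mul1r; apply: JM.
rewrite exprS poly_realM => Jff.
have stab B : J B -> J (poly_real f * B) by move=> JB; rewrite poly_realC; apply: JM.
by case: (cpJ _ _ Jff stab) => [Jf|Jfk]; [exact: Jf|exact: IH].
Qed.

Lemma real_part_nullstellensatz f :
  (forall z, (forall g, real_part I g -> ceval z g = 0) -> ceval z f = 0) -> real_part I f.
Proof.
move=> fz; apply: contrapT => nIf.
have [|z [zI /eqP]] := @real_nullstellensatz _ _ (real_part I) f real_part_ideal.
  by move=> k /real_part_radical.
by apply; apply: fz.
Qed.

(** The symmetrization of a real polynomial is its square. *)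
Lemma real_torsion_free P f : I (P * poly_real f) -> I P \/ real_part I f.
Proof.
case/qp_I; [by left|move=> If; right; apply: (@real_part_radical _ 2)].
rewrite /real_part /=; have [e0 e1 e2 e3] := components_real f.
suff -> : f ^+ 2 = poly_norm (poly_real f) by rewrite -symm_poly_norm.
by rewrite /poly_norm e0 e1 e2 e3 !expr0n !addr0.
Qed.

Lemma poly_norm_real_part G : I G -> real_part I (poly_norm G).
Proof.
by case: ideal_I => I0 ID IM IG; rewrite /real_part /= -symm_poly_norm; apply: IM.
Qed.

Lemma components_in P : (forall f, components P f -> real_part I f) -> I P.
Proof.
case: ideal_I => I0 ID IM PI; rewrite [P]components_decomp.
have [p0 p1 p2 p3] : [/\ I (poly_real (poly_re P)), I (poly_real (poly_i P)),
    I (poly_real (poly_j P)) & I (poly_real (poly_k P))].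
  by split; apply: PI; [apply: Or41|apply: Or42|apply: Or43|apply: Or44].
by apply: (ID); [apply: (ID); [apply: (ID); [exact: p0|]|]|]; apply: IM.
Qed.

(** The complex Nullstellensatz, applied to each real component. *)
Lemma mem_of_vanishes_on_spheres P :
  (forall z, (forall g, real_part I g -> ceval z g = 0) ->
    ev_re z P = 0 /\ ev_im z P = 0) -> I P.
Proof.
move=> Pz; apply: components_in => f Pf.
apply: real_part_nullstellensatz => z /Pz/ev_eq0P[].
by case: Pf => ->.
Qed.

(** The symmetrizations of the elements of I are real and lie in I. *)
Lemma real_part_zero_lift z : (forall g, real_part I g -> ceval z g = 0) ->
  exists J, J * J = -1 /\ zeros_at I J z.
Proof. by move=> zI; apply: common_zero => // P /poly_norm_real_part /zI. Qed.

(** Through [P * (G + conj G) = G * P + conj G * P] for G in I, it is enough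
    that some real polynomial G + conj G lies outside I. When there is none,
    I vanishes on the whole sphere of every zero of its real part, and so
    does P. *)
Lemma strong_nullstellensatz P :
  (forall J z, J * J = -1 -> zeros_at I J z -> ev_re z P + J * ev_im z P = 0) -> I P.
Proof.
move=> PV; have [I0 ID IM] := ideal_I.
have conjG G : I G -> I (rconj G * P).
  move=> IG; apply: mem_of_vanishes_on_spheres => z /real_part_zero_lift[J [JJ JI]].
  by apply: (@rconj_mul_vanishes J) => //; [apply: JI|apply: PV].
have [[G [IG nG]]|allG] := pselect (exists G, I G /\ ~ real_part I (poly_re G)).
  have /real_torsion_free[//|] : I (P * poly_real (poly_re G + poly_re G)).
    have -> : P * poly_real (poly_re G + poly_re G) = G * P + rconj G * P.
      rewrite -poly_realC -mulrDl; congr (_ * _).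
      have [e0 e1 e2 e3] := components_real (poly_re G + poly_re G).
      have [f0 f1 f2 f3] := components_rconj G.
      have [g0 g1 g2 g3] := componentsD G (rconj G).
      by apply: components_eq;
        rewrite (e0, e1, e2, e3) (g0, g1, g2, g3) (f0, f1, f2, f3) ?subrr.
    by apply: ID; [apply: IM|apply: conjG].
  have [_ _ AM] := real_part_ideal.
  move=> I2G; case: nG.
  suff <- : (poly_re G + poly_re G) * (2^-1)%:MP = poly_re G by apply: AM.
  by rewrite mulrDl -mulrDr -mpolyCD (_ : 2^-1 + 2^-1 = 1) ?mpolyC1 ?mulr1 //; field.
(* Multiplying G on the right by a quaternion unit moves any component to the real one. *)
have allI G f : I G -> components G f -> real_part I f.
  move=> IG Gf; apply: contrapT => nf; apply: allG.
  have [q fq] : exists q : H, poly_re (G * q%:MP) = f.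
    have re_mul_const (q : H) : poly_re (G * q%:MP) = poly_re G * (qre q)%:MP -
        poly_i G * (qi q)%:MP - poly_j G * (qj q)%:MP - poly_k G * (qk q)%:MP.
      by rewrite poly_reM; have [-> -> -> ->] := components_const n q.
    case: Gf => ->; [exists 1|exists (Quat 0 (-1) 0 0)|
      exists (Quat 0 0 (-1) 0)|exists (Quat 0 0 0 (-1))];
    rewrite re_mul_const /= !(mpolyC0, mpolyCN, mpolyC1); ring.
  by exists (G * q%:MP); rewrite fq; split=> //; apply: IM.
apply: mem_of_vanishes_on_spheres => z zI.
have zG G : I G -> ev_re z G = 0 /\ ev_im z G = 0.
  move=> IG; apply/ev_eq0P.
  by split; apply: zI; apply: (allI G) => //;
    [apply: Or41|apply: Or42|apply: Or43|apply: Or44].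
have PJ J : J * J = -1 -> ev_re z P + J * ev_im z P = 0.
  by move=> JJ; apply: PV => // G /zG[-> ->]; rewrite mulr0 addr0.
have [J [JJ _ _]] := third_imag_unit (0 : H) (0 : H).
have [J' [JJ' J'J _]] := third_imag_unit J J.
by apply: (two_zeros J'J); apply: PJ.
Qed.

End QuasiPrimeRadical.

End Points.

(** * Irreducibility *)

Theorem theorem5p17 (R : realType) (n : nat) (I : set {mpoly (quat R)[n]}) :
  right_ideal I ->
  quasi_prime I ->
  is_radical I ->
  irreducible (sphere_set (Vc I)) ->
  irreducible (Vc I).
Proof.
move=> idI qpI radI _ [I1 [I2 [[id1 id2] _ _ VE [V12 V21]]]].
have {VE} zerosE J z : J * J = -1 ->
    zeros_at I J z <-> zeros_at I1 J z \/ zeros_at I2 J z.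
  by move=> JJ; rewrite -!Vc_slice_pt // VE.
have nonincl (K K' : set {mpoly (quat R)[n]}) : ~ Vc K `<=` Vc K' ->
    exists J z P, [/\ J * J = -1, zeros_at K J z, K' P & ev_re z P + J * ev_im z P <> 0].
  move=> /existsNP[a /not_implyP[Ka nK'a]].
  have [J [z [JJ aE]]] := Vc_in_slice Ka; rewrite aE !Vc_slice_pt // in Ka nK'a.
  by have /existsNP[P /not_implyP[K'P Pz]] := nK'a; exists J, z, P.
have [Ja [za [P2 [JJa za1 I2P2 P2a]]]] := nonincl _ _ V12.
have [Jb [zb [P1 [JJb zb2 I1P1 P1b]]]] := nonincl _ _ V21.
have nIP2 : ~ I P2.
  by move=> IP2; apply: P2a; apply: (proj2 (zerosE _ _ JJa) (or_introl za1)).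
have nIP1 : ~ I P1.
  by move=> IP1; apply: P1b; apply: (proj2 (zerosE _ _ JJb) (or_intror zb2)).
(* Real torsion-freeness, in geometric form. *)
have key P f : ~ I P ->
    (forall J z, J * J = -1 -> zeros_at I J z ->
       ev_re z P + J * ev_im z P = 0 \/ ceval z f = 0) ->
    forall J z, J * J = -1 -> zeros_at I J z -> ceval z f = 0.
  move=> nIP Pf J z JJ zI.
  have /(real_torsion_free qpI radI)[//|If] : I (P * poly_real f).
    apply: (strong_nullstellensatz idI qpI radI) => J' z' JJ' z'I.
    by have [P0|f0] := Pf _ _ JJ' z'I; [apply: zero_at_mulr|
      apply: zero_at_mul_real].
  exact: (zero_at_real JJ (zI _ If)).
(* [P1] times the symmetrization of an element of I2 vanishes on both pieces. *)
have meets2 J z : J * J = -1 -> zeros_at I J z ->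
    exists J', J' * J' = -1 /\ zeros_at I2 J' z.
  move=> JJ zI; apply: common_zero => // F I2F.
  apply: (key P1 (poly_norm F) nIP1 _ J z JJ zI) => J' z' JJ' /zerosE[//|zI1|zI2].
    by left; apply: zI1.
  by right; apply: (zero_at_poly_norm JJ'); apply: zI2.
(* Off the zeros of a component of [P1], the first piece meets a sphere in at most
   one point, and that point is shared with the second piece. *)
have P1z J z f : components P1 f -> ceval z f <> 0 -> J * J = -1 -> zeros_at I J z ->
    zeros_at I1 J z -> zeros_at I2 J z.
  move=> P1f fz JJ zI zI1.
  have only J' : J' * J' = -1 -> zeros_at I1 J' z -> J' = J.
    move=> JJ' zI1'; apply: contrapT => /eqP JJn; case: fz.
    have /ev_eq0P[c0 c1 c2 c3] := two_zeros JJn (zI1' _ I1P1) (zI1 _ I1P1).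
    by case: P1f => ->.
  have [J2 [JJ2 zI2]] := meets2 _ _ JJ zI.
  have [<-//|/eqP J2J] := pselect (J2 = J).
  have zIs J' : J' * J' = -1 -> zeros_at I J' z.
    move=> _ Q IQ.
    have /(zerosE _ _ JJ2) zIJ2 : zeros_at I1 J2 z \/ zeros_at I2 J2 z by right.
    by have [-> ->] := two_zeros J2J (zIJ2 _ IQ) (zI _ IQ); rewrite mulr0 addr0.
  (* Two distinct zeros of I on the sphere: I vanishes on all of it. A third
     unit gives a point outside the first piece, a second zero of I2. *)
  have [J3 [JJ3 J3J J3J2]] := third_imag_unit J J2.
  have zI23 : zeros_at I2 J3 z.
    have /zerosE[//|/(only _ JJ3) J3E|//] := zIs _ JJ3.
    by rewrite J3E eqxx in J3J.
  move=> Q I2Q.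
  by have [-> ->] := two_zeros J3J2 (zI23 _ I2Q) (zI2 _ I2Q); rewrite mulr0 addr0.
have zbI : zeros_at I Jb zb by apply/zerosE; [|right].
apply: P1b; have P1f f : components P1 f -> ceval zb f = 0.
  move=> P1f; apply: (key P2 f nIP2 _ Jb zb JJb zbI) => J z JJ zI.
  have [fz|fz] := pselect (ceval z f = 0); first by right.
  left; have /zerosE[//|zI1|zI2] := zI; last exact: zI2.
  exact: (P1z _ _ _ P1f fz JJ zI zI1).
have [-> ->] : ev_re zb P1 = 0 /\ ev_im zb P1 = 0.
  by apply/ev_eq0P; split; apply: P1f;
    [apply: Or41|apply: Or42|apply: Or43|apply: Or44].
by rewrite mulr0 addr0.
Qed.
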